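(* Let $c\in\mathbb{E}^3$, $r>0$, let $x:U\to\mathbb{E}^3\setminus\{c\}$ be a regular patch and let $y=\Phi\circ x$ be its inverse patch, where $\Phi$ is the inversion with center $c$ and radius $r$. Let $I$, $II$, $III$ be the first, second and third fundamental forms of $x$ and let $\widetilde{III}$ be the third fundamental form of $y$. Then $$\widetilde{III}\circ\Phi_*=III+2\xi\, II+\xi^2 I,\qquad \xi=\frac{2\langle U_x,\,x-c\rangle}{\|x-c\|^2},$$ that is, at every $(u,v)\in U$ with $p=x(u,v)$, $q=\Phi(p)$, and all tangent vectors $u_p,v_p\in T_p(x)$, $\widetilde{III}_q(\Phi_{*p}u_p,\Phi_{*p}v_p)=III_p(u_p,v_p)+2\xi\, II_p(u_p,v_p)+\xi^2 I_p(u_p,v_p)$.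
   Context: $\mathbb{E}^3$ is Euclidean 3-space. The inversion with center $c$ and radius $r$ is $\Phi:\mathbb{E}^3\setminus\{c\}\to\mathbb{E}^3\setminus\{c\}$, $\Phi(p)=c+\frac{r^2}{\|p-c\|^2}(p-c)$, with tangent map $\Phi_{*p}(v_p)=\frac{r^2 v_p}{\|p-c\|^2}-\frac{2r^2\langle p-c,v_p\rangle}{\|p-c\|^4}(p-c)$. A regular patch is a smooth map $x:U\to\mathbb{E}^3\setminus\{c\}$, $U\subset\mathbb{R}^2$ open, with $x_u\times x_v\neq0$ everywhere; $y=\Phi\circ x$ is then also regular. At a parameter $(u,v)$, $T_p(x)=\mathrm{span}(x_u,x_v)$ with $p=x(u,v)$ (similarly for $y$ at $q=\Phi(p)$). The unit normals are $U_x=\frac{x_u\times x_v}{\|x_u\times x_v\|}$ and $U_y=\frac{y_u\times y_v}{\|y_u\times y_v\|}$. The shape operator $S$ of $x$ is the linear map with $S(x_u)=-\partial_uU_x$, $S(x_v)=-\partial_vU_x$, and the shape operator $\tilde S$ of $y$ is defined likewise using $U_y$. The fundamental forms of $x$ are $I(a,b)=\langle a,b\rangle$, $II(a,b)=\langle S a,b\rangle$, $III(a,b)=\langle S^2a,b\rangle=\langle Sa,Sb\rangle$; those of $y$ are defined likewise with $\tilde S$ and are denoted by tildes. *)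

(* Defs.v *)
From Stdlib Require Import Reals Lra ClassicalEpsilon.
From Coquelicot Require Import Coquelicot.
Open Scope R_scope.

(* Euclidean 3-space; [plus], [scal], [opp], [minus], [zero] are Coquelicot's
   operations on the product module. *)
Notation E3 := (R * R * R)%type.

Definition cx (a : E3) : R := fst (fst a).
Definition cy (a : E3) : R := snd (fst a).
Definition cz (a : E3) : R := snd a.

Definition dot (a b : E3) : R := cx a * cx b + cy a * cy b + cz a * cz b.

Definition enorm (a : E3) : R := sqrt (dot a a).

Definition cross (a b : E3) : E3 :=
  (cy a * cz b - cz a * cy b,
   cz a * cx b - cx a * cz b,
   cx a * cy b - cy a * cx b).

(* The value at [p = c] is irrelevant. *)
Definition inversion (c : E3) (r : R) (p : E3) : E3 :=
  plus c (scal (r ^ 2 / enorm (minus p c) ^ 2) (minus p c)).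

Definition inversion_tangent (c : E3) (r : R) (p v : E3) : E3 :=
  minus (scal (r ^ 2 / enorm (minus p c) ^ 2) v)
        (scal (2 * r ^ 2 * dot (minus p c) v / enorm (minus p c) ^ 4)
              (minus p c)).

(* Maps defined on an open set U of the plane are represented by total
   functions; since U is open, derivatives at points of U depend only on the
   values on U. *)
Definition partial_u (f : R -> R -> E3) (u v : R) : E3 :=
  (Derive (fun t => cx (f t v)) u,
   Derive (fun t => cy (f t v)) u,
   Derive (fun t => cz (f t v)) u).

Definition partial_v (f : R -> R -> E3) (u v : R) : E3 :=
  (Derive (fun t => cx (f u t)) v,
   Derive (fun t => cy (f u t)) v,
   Derive (fun t => cz (f u t)) v).

(* [ex_diff_n g n u v]: all iterated partial derivatives of g up to order n
   exist and are continuous at (u, v). *)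
Definition smooth_on (U : R * R -> Prop) (f : R -> R -> E3) : Prop :=
  forall (n : nat) (u v : R), U (u, v) ->
    ex_diff_n (fun s t => cx (f s t)) n u v /\
    ex_diff_n (fun s t => cy (f s t)) n u v /\
    ex_diff_n (fun s t => cz (f s t)) n u v.

Definition regular_patch (U : R * R -> Prop) (x : R -> R -> E3) : Prop :=
  open U /\ smooth_on U x /\
  forall u v : R, U (u, v) -> cross (partial_u x u v) (partial_v x u v) <> zero.

Definition tangent (x : R -> R -> E3) (u v : R) (w : E3) : Prop :=
  exists a b : R, w = plus (scal a (partial_u x u v)) (scal b (partial_v x u v)).

Definition unit_normal (x : R -> R -> E3) (u v : R) : E3 :=
  scal (/ enorm (cross (partial_u x u v) (partial_v x u v)))
       (cross (partial_u x u v) (partial_v x u v)).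

(* Only the restriction of S to the tangent space matters. *)
Definition is_shape_operator (x : R -> R -> E3) (u v : R) (S : E3 -> E3) : Prop :=
  (forall a b : E3, tangent x u v a -> tangent x u v b ->
     S (plus a b) = plus (S a) (S b)) /\
  (forall (k : R) (a : E3), tangent x u v a -> S (scal k a) = scal k (S a)) /\
  S (partial_u x u v) = opp (partial_u (unit_normal x) u v) /\
  S (partial_v x u v) = opp (partial_v (unit_normal x) u v).

Definition shape_operator (x : R -> R -> E3) (u v : R) : E3 -> E3 :=
  epsilon (inhabits (fun w : E3 => w)) (is_shape_operator x u v).

Definition first_form (x : R -> R -> E3) (u v : R) (a b : E3) : R := dot a b.

Definition second_form (x : R -> R -> E3) (u v : R) (a b : E3) : R :=
  dot (shape_operator x u v a) b.

Definition third_form (x : R -> R -> E3) (u v : R) (a b : E3) : R :=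
  dot (shape_operator x u v (shape_operator x u v a)) b.

Lemma E3_eq (a b : E3) : cx a = cx b -> cy a = cy b -> cz a = cz b -> a = b.
Proof.
destruct a as [[a1 a2] a3], b as [[b1 b2] b3]; unfold cx, cy, cz; simpl.
now intros -> -> ->.
Qed.

Lemma cross_neq0 (a b : E3) :
  cross a b <> zero -> dot (cross a b) (cross a b) <> 0.
Proof.
intros Hn H; apply Hn; unfold dot in H.
apply E3_eq; change (cx zero) with 0; change (cy zero) with 0;
  change (cz zero) with 0; nra.
Qed.

Ltac E3_calc :=
  apply E3_eq; unfold cx, cy, cz; simpl;
  repeat (progress (unfold plus, scal, opp, mult; simpl)).

Lemma shape_operatorP (x : R -> R -> E3) (u v : R) :
  cross (partial_u x u v) (partial_v x u v) <> zero ->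
  is_shape_operator x u v (shape_operator x u v).
Proof.
intros Hn; unfold shape_operator; apply epsilon_spec.
apply cross_neq0 in Hn; revert Hn; unfold is_shape_operator.
generalize (partial_u (unit_normal x) u v) (partial_v (unit_normal x) u v).
intros Nu Nv Hn.
set (e := partial_u x u v) in *; set (f := partial_v x u v) in *.
set (n := cross e f) in *.
exists (fun w => opp (plus (scal (dot (cross w f) n / dot n n) Nu)
                           (scal (dot (cross e w) n / dot n n) Nv))).
destruct e as [[e1 e2] e3], f as [[f1 f2] f3].
destruct Nu as [[p1 p2] p3], Nv as [[q1 q2] q3].
unfold n, dot, cross, cx, cy, cz in *; simpl in *.
repeat split.
- intros [[a1 a2] a3] [[b1 b2] b3] _ _.
  E3_calc; field; exact Hn.
- intros k [[a1 a2] a3] _.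
  E3_calc; field; exact Hn.
- E3_calc; field; exact Hn.
- E3_calc; field; exact Hn.
Qed.

Lemma shape_operator_unique (x : R -> R -> E3) (u v : R) (S S' : E3 -> E3) :
  is_shape_operator x u v S -> is_shape_operator x u v S' ->
  forall w : E3, tangent x u v w -> S w = S' w.
Proof.
intros [A [M [Eu Ev]]] [A' [M' [Eu' Ev']]] w [a [b ->]].
assert (Tu : tangent x u v (partial_u x u v)).
{ exists 1, 0; E3_calc; ring. }
assert (Tv : tangent x u v (partial_v x u v)).
{ exists 0, 1; E3_calc; ring. }
assert (Ta : tangent x u v (scal a (partial_u x u v))).
{ exists a, 0; E3_calc; ring. }
assert (Tb : tangent x u v (scal b (partial_v x u v))).
{ exists 0, b; E3_calc; ring. }
pose proof (A _ _ Ta Tb) as H; pose proof (A' _ _ Ta Tb) as H'.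
rewrite (M _ _ Tu), (M _ _ Tv), Eu, Ev in H.
rewrite (M' _ _ Tu), (M' _ _ Tv), Eu', Ev' in H'.
exact (eq_trans H (eq_sym H')).
Qed.

(* Main.v *)
(** Write [d = x - c] and let [R] be the reflection in the plane orthogonal to
    [d].  The tangent map of the inversion is [l R] with [l = r^2 / |d|^2], and
    since [R] reverses orientation, [U_y = - R U_x = - U_x + xi d].
    Differentiating, [dU_y = - R (dU_x - xi dx)], which says that the shape
    operator of [y] satisfies [S~ (l R a) = - R (S a + xi a)].  Hence
    [S~ (S~ (l R a)) = l^-1 R (S + xi)^2 a], and pairing with [l R b] gives the
    claim because [R] is an isometry. *)

Require Import Defs.
From Stdlib Require Import Reals Lra.
From Coquelicot Require Import Coquelicot.
Open Scope R_scope.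

(** * Vector algebra in Euclidean 3-space *)

Ltac E3_unfold :=
  unfold cross, dot, cx, cy, cz in *; simpl in *;
  do 3 (unfold minus, plus, scal, opp, mult, zero in *; simpl in *).

Ltac E3_ext := apply E3_eq; E3_unfold.

Lemma dot_pos (a : E3) : a <> zero -> 0 < dot a a.
Proof.
intros Ha; destruct (Rle_lt_dec (dot a a) 0) as [H|H]; [|exact H].
exfalso; apply Ha; unfold dot in H; apply E3_eq; change (cx zero) with 0;
  change (cy zero) with 0; change (cz zero) with 0; nra.
Qed.

Lemma minus_neq0 (a b : E3) : a <> b -> minus a b <> zero.
Proof.
intros Hab H; apply Hab.
pose proof (f_equal cx H); pose proof (f_equal cy H); pose proof (f_equal cz H).
clear H Hab; destruct a as [[a1 a2] a3], b as [[b1 b2] b3]; E3_ext; lra.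
Qed.

Lemma enorm_sq (a : E3) : enorm a ^ 2 = dot a a.
Proof. unfold enorm; apply pow2_sqrt; unfold dot; nra. Qed.

Lemma enorm_scal (k : R) (a : E3) : enorm (scal k a) = Rabs k * enorm a.
Proof.
unfold enorm; rewrite <- (sqrt_Rsqr_abs k), <- sqrt_mult_alt.
- f_equal; destruct a as [[a1 a2] a3]; E3_unfold; unfold Rsqr; ring.
- apply Rle_0_sqr.
Qed.

Lemma enorm_pos (a : E3) : a <> zero -> 0 < enorm a.
Proof. intros Ha; apply sqrt_lt_R0, dot_pos, Ha. Qed.

Lemma dot_scal (k l : R) (a b : E3) : dot (scal k a) (scal l b) = k * l * dot a b.
Proof. destruct a as [[a1 a2] a3], b as [[b1 b2] b3]; E3_unfold; ring. Qed.

Lemma cross_scal (k : R) (a b : E3) :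
  cross (scal k a) (scal k b) = scal (k ^ 2) (cross a b).
Proof. destruct a as [[a1 a2] a3], b as [[b1 b2] b3]; E3_ext; ring. Qed.

Lemma orthogonal_cross_span (e f w : E3) :
  cross e f <> zero -> dot w (cross e f) = 0 ->
  exists a b : R, w = plus (scal a e) (scal b f).
Proof.
intros Hn Hw; apply dot_pos in Hn.
set (n := cross e f) in *.
exists (dot (cross w f) n / dot n n), (dot (cross e w) n / dot n n).
(* Cramer's rule in the basis [e], [f], [n], whose determinant is [dot n n], cleared of denominators
   so that it is a polynomial identity. The hypothesis then kills the [n]-component. *)
assert (E : scal (dot n n) w = plus (plus (scal (dot (cross w f) n) e)
              (scal (dot (cross e w) n) f)) (scal (dot w n) n)).
{ unfold n; destruct e as [[e1 e2] e3], f as [[f1 f2] f3], w as [[w1 w2] w3];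
  E3_ext; ring. }
rewrite Hw in E.
assert (E' : w = scal (/ dot n n) (scal (dot n n) w)).
{ rewrite scal_assoc; unfold mult; simpl.
  rewrite Rinv_l by lra; symmetry; apply (scal_one w). }
rewrite E' at 1; rewrite E; clear E E' Hw.
generalize dependent (dot n n); intros N HN.
generalize (dot (cross w f) n) (dot (cross e w) n); intros p q.
destruct e as [[e1 e2] e3], f as [[f1 f2] f3], n as [[n1 n2] n3]; E3_ext; field; lra.
Qed.

(** * Reflection in the plane orthogonal to a vector *)

Definition refl (d v : E3) : E3 := minus v (scal (2 * dot d v / dot d d) d).

Lemma refl_plus (d a b : E3) : refl d (plus a b) = plus (refl d a) (refl d b).
Proof.
unfold refl, Rdiv; generalize (/ dot d d); intros D.
destruct a as [[a1 a2] a3], b as [[b1 b2] b3], d as [[d1 d2] d3]; E3_ext; ring.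
Qed.

Lemma refl_scal (d : E3) (k : R) (a : E3) : refl d (scal k a) = scal k (refl d a).
Proof.
unfold refl, Rdiv; generalize (/ dot d d); intros D.
destruct a as [[a1 a2] a3], d as [[d1 d2] d3]; E3_ext; ring.
Qed.

Lemma dot_refl (d a b : E3) : d <> zero -> dot (refl d a) (refl d b) = dot a b.
Proof.
intros Hd; apply dot_pos in Hd.
destruct a as [[a1 a2] a3], b as [[b1 b2] b3], d as [[d1 d2] d3].
unfold refl; E3_unfold; field; lra.
Qed.

Lemma enorm_refl (d a : E3) : d <> zero -> enorm (refl d a) = enorm a.
Proof. intros Hd; unfold enorm; now rewrite dot_refl. Qed.

(** An orthogonal map commutes with the cross product up to its determinant, which is -1 for a
    reflection. *)
Lemma cross_refl (d a b : E3) :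
  d <> zero -> cross (refl d a) (refl d b) = scal (-1) (refl d (cross a b)).
Proof.
intros Hd; apply dot_pos in Hd.
destruct a as [[a1 a2] a3], b as [[b1 b2] b3], d as [[d1 d2] d3].
unfold refl; E3_ext; field; lra.
Qed.

(** Factoring out the conformal factor of the inversion leaves an isometry. *)
Lemma inversion_tangent_refl (c : E3) (r : R) (p v : E3) :
  p <> c ->
  inversion_tangent c r p v = scal (r ^ 2 / dot (minus p c) (minus p c)) (refl (minus p c) v).
Proof.
intros Hp; apply minus_neq0, dot_pos in Hp; unfold inversion_tangent, refl.
replace (enorm (minus p c) ^ 4) with ((enorm (minus p c) ^ 2) ^ 2) by ring.
rewrite enorm_sq; set (d := minus p c) in *.
generalize dependent (dot d d); intros D HD; generalize (dot d v); intros k.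
destruct v as [[v1 v2] v3], d as [[d1 d2] d3]; E3_ext; field; lra.
Qed.

(** * Componentwise differentiation of curves in space *)

Definition is_curve_derive (f : R -> E3) (t : R) (l : E3) : Prop :=
  is_derive (fun s => cx (f s)) t (cx l) /\
  is_derive (fun s => cy (f s)) t (cy l) /\
  is_derive (fun s => cz (f s)) t (cz l).

(** For a coordinate curve of a patch the left side is [partial_u] or [partial_v] unfolded, so a
    derivative found by the calculus rules becomes an equation for the partial derivative. *)
Lemma is_curve_derive_unique (f : R -> E3) (t : R) (l : E3) :
  is_curve_derive f t l ->
  (Derive (fun s => cx (f s)) t, Derive (fun s => cy (f s)) t,
   Derive (fun s => cz (f s)) t) = l.
Proof. intros [H1 [H2 H3]]; apply E3_eq; apply is_derive_unique; assumption. Qed.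

(** Formulas for the inverse patch are known only over [U], so the coordinate curves to be compared
    agree only near the parameter. *)
Lemma is_curve_derive_ext_loc (f g : R -> E3) (t : R) (l : E3) :
  locally t (fun s => f s = g s) -> is_curve_derive f t l -> is_curve_derive g t l.
Proof.
intros E [H1 [H2 H3]]; split; [|split].
- exact (is_derive_ext_loc _ (fun s => cx (g s)) _ _
    (filter_imp _ _ (fun s e => f_equal cx e) E) H1).
- exact (is_derive_ext_loc _ (fun s => cy (g s)) _ _
    (filter_imp _ _ (fun s e => f_equal cy e) E) H2).
- exact (is_derive_ext_loc _ (fun s => cz (g s)) _ _
    (filter_imp _ _ (fun s e => f_equal cz e) E) H3).
Qed.

Lemma is_derive_mult_R (f g : R -> R) (t l m : R) :
  is_derive f t l -> is_derive g t m ->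
  is_derive (fun s => f s * g s) t (l * g t + f t * m).
Proof. intros Hf Hg; apply (is_derive_mult f g t l m Hf Hg Rmult_comm). Qed.

Lemma is_curve_derive_plus (f g : R -> E3) (t : R) (l m : E3) :
  is_curve_derive f t l -> is_curve_derive g t m ->
  is_curve_derive (fun s => plus (f s) (g s)) t (plus l m).
Proof.
intros [F1 [F2 F3]] [G1 [G2 G3]]; split; [|split].
- exact (is_derive_plus _ _ _ _ _ F1 G1).
- exact (is_derive_plus _ _ _ _ _ F2 G2).
- exact (is_derive_plus _ _ _ _ _ F3 G3).
Qed.

Lemma is_curve_derive_const (a : E3) (t : R) : is_curve_derive (fun _ => a) t zero.
Proof. split; [|split]; apply (@is_derive_const R_AbsRing R_NormedModule). Qed.

Lemma is_curve_derive_minus_const (f : R -> E3) (a : E3) (t : R) (l : E3) :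
  is_curve_derive f t l -> is_curve_derive (fun s => minus (f s) a) t l.
Proof.
intros F; rewrite <- (plus_zero_r l).
exact (is_curve_derive_plus _ _ _ _ _ F (is_curve_derive_const (opp a) t)).
Qed.

Lemma is_curve_derive_scal (k : R -> R) (f : R -> E3) (t m : R) (l : E3) :
  is_derive k t m -> is_curve_derive f t l ->
  is_curve_derive (fun s => scal (k s) (f s)) t (plus (scal m (f t)) (scal (k t) l)).
Proof.
intros K [F1 [F2 F3]]; split; [|split].
- exact (is_derive_mult_R _ _ _ _ _ K F1).
- exact (is_derive_mult_R _ _ _ _ _ K F2).
- exact (is_derive_mult_R _ _ _ _ _ K F3).
Qed.

Lemma is_derive_dot (f g : R -> E3) (t : R) (l m : E3) :
  is_curve_derive f t l -> is_curve_derive g t m ->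
  is_derive (fun s => dot (f s) (g s)) t (dot l (g t) + dot (f t) m).
Proof.
intros [F1 [F2 F3]] [G1 [G2 G3]]; unfold dot.
pose proof (is_derive_plus _ _ _ _ _ (is_derive_plus _ _ _ _ _
  (is_derive_mult_R _ _ _ _ _ F1 G1) (is_derive_mult_R _ _ _ _ _ F2 G2))
  (is_derive_mult_R _ _ _ _ _ F3 G3)) as H.
refine (eq_ind _ (is_derive _ t) H _ _); unfold plus; simpl; ring.
Qed.

Lemma is_curve_derive_cross (f g : R -> E3) (t : R) (l m : E3) :
  is_curve_derive f t l -> is_curve_derive g t m ->
  is_curve_derive (fun s => cross (f s) (g s)) t (plus (cross l (g t)) (cross (f t) m)).
Proof.
intros [F1 [F2 F3]] [G1 [G2 G3]]; split; [|split]; (eapply eq_ind; [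
  apply (@is_derive_minus R_AbsRing R_NormedModule); apply is_derive_mult_R; eassumption |]);
  unfold cross, cx, cy, cz; simpl; unfold minus, plus, opp; simpl; ring.
Qed.

Lemma is_derive_inv_dot (f : R -> E3) (t : R) (l : E3) :
  is_curve_derive f t l -> f t <> zero ->
  is_derive (fun s => / dot (f s) (f s)) t (- (2 * dot (f t) l) / dot (f t) (f t) ^ 2).
Proof.
intros F Hf; apply dot_pos in Hf.
eapply eq_ind; [apply is_derive_inv; [apply (is_derive_dot _ _ _ _ _ F F)|lra]|].
simpl; replace (dot l (f t)) with (dot (f t) l) by (unfold dot; ring).
field; lra.
Qed.

Lemma is_curve_derive_inversion (c : E3) (r : R) (f : R -> E3) (t : R) (l : E3) :
  is_curve_derive f t l -> f t <> c ->
  is_curve_derive (fun s => inversion c r (f s)) t (inversion_tangent c r (f t) l).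
Proof.
intros F Hf; rewrite inversion_tangent_refl by exact Hf.
pose proof (is_curve_derive_minus_const _ c _ _ F) as D.
pose proof (is_derive_inv_dot _ _ _ D (minus_neq0 _ _ Hf)) as I.
(* The product rule for [c + r^2 |d|^-2 d] with [d = f - c]: the derivative of [|d|^-2] produces the
   component along [d] that turns [l] into its reflection. *)
pose proof (is_curve_derive_plus _ _ _ _ _ (is_curve_derive_const c t)
  (is_curve_derive_scal _ _ _ _ _
    (is_derive_scal _ _ (r ^ 2) _ I) D)) as H.
apply (is_curve_derive_ext_loc _ (fun s => inversion c r (f s))) in H.
- refine (eq_ind _ (is_curve_derive _ t) H _ _); clear H I D; unfold refl.
  apply minus_neq0, dot_pos in Hf; set (d := minus (f t) c) in *.
  clearbody d; generalize dependent (dot d d); intros N HN; generalize (dot d l).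
  intros k; destruct d as [[d1 d2] d3], l as [[l1 l2] l3]; E3_ext; field; lra.
- apply filter_forall; intros s; unfold inversion; now rewrite enorm_sq.
Qed.

(** Existence suffices: for the unit normal of a patch, uniqueness identifies the derivative with
    [partial_u] or [partial_v] of [unit_normal]. *)
Lemma ex_curve_derive_normalize (f : R -> E3) (t : R) (l : E3) :
  is_curve_derive f t l -> f t <> zero ->
  exists m, is_curve_derive (fun s => scal (/ enorm (f s)) (f s)) t m.
Proof.
intros F Hf; eexists; apply is_curve_derive_scal; [|exact F].
pose proof (enorm_pos _ Hf) as Hn.
apply is_derive_inv; [|lra].
apply (is_derive_sqrt (fun s => dot (f s) (f s))); [apply (is_derive_dot _ _ _ _ _ F F)|].
apply dot_pos, Hf.
Qed.

(* With [n] the unit normal of a patch along the coordinate curve [f], the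
   curve differentiated here is the unit normal of the inverse patch.  The
   hypothesis on [dot (n t) l] removes the derivative of [f] from that of
   [dot n (f - c)]. *)
Lemma is_curve_derive_reflected_normal (c : E3) (f n : R -> E3) (t : R) (l m : E3) :
  is_curve_derive f t l -> is_curve_derive n t m -> f t <> c -> dot (n t) l = 0 ->
  let d := minus (f t) c in
  is_curve_derive (fun s => scal (-1) (refl (minus (f s) c) (n s))) t
    (scal (-1) (refl d (plus m (scal (- (2 * dot (n t) d / dot d d)) l)))).
Proof.
intros F N Hf Hnl d.
pose proof (is_curve_derive_minus_const _ c _ _ F) as D.
pose proof (is_derive_inv_dot _ _ _ D (minus_neq0 _ _ Hf)) as I.
(* The product rule for [- R n = - n + 2 <d, n> |d|^-2 d], in which [d] moves with the curve. *)
pose proof (is_curve_derive_plus _ _ _ _ _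
  (is_curve_derive_scal _ _ _ _ _ (is_derive_const (-1) t) N)
  (is_curve_derive_scal _ _ _ _ _
    (is_derive_mult_R _ _ _ _ _
      (is_derive_scal _ _ 2 _ (is_derive_dot _ _ _ _ _ D N)) I) D)) as H.
apply (is_curve_derive_ext_loc _
  (fun s => scal (-1) (refl (minus (f s) c) (n s)))) in H.
- refine (eq_ind _ (is_curve_derive _ t) H _ _); clear H I D; unfold refl.
  apply minus_neq0, dot_pos in Hf; fold d in Hf |- *.
  replace (dot l (n t)) with 0 by (rewrite <- Hnl; unfold dot; ring).
  replace (dot (n t) d) with (dot d (n t)) by (unfold dot; ring).
  replace (dot d (plus m (scal (- (2 * dot d (n t) / dot d d)) l)))
    with (dot d m - 2 * dot d (n t) / dot d d * dot d l)
    by (clear; generalize (2 * dot d (n t) / dot d d); intros k;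
        destruct d as [[d1 d2] d3], l as [[l1 l2] l3], m as [[m1 m2] m3]; E3_unfold; ring).
  (* From here the scalar products are independent scalars: the two derivatives agree without any
     relation between these and the coordinates. *)
  clearbody d; clear - Hf; generalize dependent (dot d d); intros k Hk.
  generalize (dot d l) (dot d m) (dot d (n t)) (n t); intros p q s [[n1 n2] n3].
  destruct d as [[d1 d2] d3], l as [[l1 l2] l3], m as [[m1 m2] m3].
  E3_ext; field; lra.
- apply filter_forall; intros s; unfold refl, Rdiv.
  generalize (minus (f s) c) (n s); intros e k; generalize (/ dot e e); intros q.
  destruct e as [[e1 e2] e3], k as [[k1 k2] k3]; E3_ext; ring.
Qed.

(** * Derivatives of a regular patch and of its unit normal *)

Lemma open_slices (U : R * R -> Prop) (u v : R) :
  open U -> U (u, v) ->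
  locally u (fun s => U (s, v)) /\ locally v (fun t => U (u, t)).
Proof.
intros HU H; destruct (HU _ H) as [e He]; split; exists e; intros s Hs;
  apply He; split; simpl; try exact Hs; apply ball_center.
Qed.

Lemma regular_patch_derive (U : R * R -> Prop) (x : R -> R -> E3) (u v : R) :
  regular_patch U x -> U (u, v) ->
  is_curve_derive (fun s => x s v) u (partial_u x u v) /\
  is_curve_derive (fun t => x u t) v (partial_v x u v).
Proof.
intros [_ [S _]] H; destruct (S 1%nat u v H) as [[_ [A1 [B1 _]]] [[_ [A2 [B2 _]]] [_ [A3 [B3 _]]]]].
split; (split; [|split]); apply Derive_correct; assumption.
Qed.

(** These derivatives make the cross product of the partials, hence the unit normal, differentiable
    along both coordinate curves. *)
Lemma regular_patch_derive2 (U : R * R -> Prop) (x : R -> R -> E3) (u v : R) :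
  regular_patch U x -> U (u, v) ->
  (exists l, is_curve_derive (fun s => partial_u x s v) u l) /\
  (exists l, is_curve_derive (fun s => partial_v x s v) u l) /\
  (exists l, is_curve_derive (fun t => partial_u x u t) v l) /\
  (exists l, is_curve_derive (fun t => partial_v x u t) v l).
Proof.
(* In each component, [A] and [B] give differentiability of [partial_u] in the first and second
   parameter, [C] and [D] that of [partial_v]. *)
intros [_ [S _]] H; destruct (S 2%nat u v H) as
  [[_ [_ [_ [[_ [A1 [B1 _]]] [_ [C1 [D1 _]]]]]]]
  [[_ [_ [_ [[_ [A2 [B2 _]]] [_ [C2 [D2 _]]]]]]]
   [_ [_ [_ [[_ [A3 [B3 _]]] [_ [C3 [D3 _]]]]]]]]].
split; [|split; [|split]]; eexists (_, _, _); (split; [|split]);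
  apply Derive_correct; eassumption.
Qed.

Lemma unit_normal_derive (U : R * R -> Prop) (x : R -> R -> E3) (u v : R) :
  regular_patch U x -> U (u, v) ->
  is_curve_derive (fun s => unit_normal x s v) u (partial_u (unit_normal x) u v) /\
  is_curve_derive (fun t => unit_normal x u t) v (partial_v (unit_normal x) u v).
Proof.
intros HX H; destruct (regular_patch_derive2 _ _ _ _ HX H)
  as [[l1 D1] [[l2 D2] [[l3 D3] [l4 D4]]]].
pose proof (proj2 (proj2 HX) u v H) as Hn.
destruct (ex_curve_derive_normalize _ _ _ (is_curve_derive_cross _ _ _ _ _ D1 D2) Hn) as [m M].
destruct (ex_curve_derive_normalize _ _ _ (is_curve_derive_cross _ _ _ _ _ D3 D4) Hn) as [m' M'].
split.
- refine (eq_ind_r (is_curve_derive _ u) M (is_curve_derive_unique _ _ _ M)).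
- refine (eq_ind_r (is_curve_derive _ v) M' (is_curve_derive_unique _ _ _ M')).
Qed.

Lemma unit_normal_unit (x : R -> R -> E3) (u v : R) :
  cross (partial_u x u v) (partial_v x u v) <> zero ->
  dot (unit_normal x u v) (unit_normal x u v) = 1.
Proof.
intros Hn; unfold unit_normal; rewrite dot_scal, <- enorm_sq.
apply enorm_pos in Hn; field; lra.
Qed.

Lemma unit_normal_orthogonal (x : R -> R -> E3) (u v : R) :
  dot (unit_normal x u v) (partial_u x u v) = 0 /\
  dot (unit_normal x u v) (partial_v x u v) = 0.
Proof.
unfold unit_normal; generalize (/ enorm (cross (partial_u x u v) (partial_v x u v))).
destruct (partial_u x u v) as [[a1 a2] a3], (partial_v x u v) as [[b1 b2] b3].
intros k; split; E3_unfold; ring.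
Qed.

(** Differentiating [<n, n> = 1] gives [2 <l, n> = 0]. *)
Lemma unit_curve_orthogonal (n : R -> E3) (t : R) (l : E3) :
  locally t (fun s => dot (n s) (n s) = 1) -> is_curve_derive n t l -> dot l (n t) = 0.
Proof.
intros H N; pose proof (is_derive_dot _ _ _ _ _ N N) as D.
apply (is_derive_ext_loc _ (fun _ => 1) _ _ H) in D.
pose proof (is_derive_unique _ _ _ D) as E; rewrite Derive_const in E.
unfold dot in *; lra.
Qed.

(** * The shape operator on the tangent plane *)

Section ShapeOperator.

Variables (x : R -> R -> E3) (u v : R).

Lemma tangent_partial :
  tangent x u v (partial_u x u v) /\ tangent x u v (partial_v x u v).
Proof. split; [exists 1, 0 | exists 0, 1]; E3_calc; ring. Qed.

Lemma tangent_plus (a b : E3) :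
  tangent x u v a -> tangent x u v b -> tangent x u v (plus a b).
Proof. intros [k [l ->]] [k' [l' ->]]; exists (k + k'), (l + l'); E3_calc; ring. Qed.

Lemma tangent_scal (k : R) (a : E3) : tangent x u v a -> tangent x u v (scal k a).
Proof. intros [m [l ->]]; exists (k * m), (k * l); E3_calc; ring. Qed.

Hypothesis regular : cross (partial_u x u v) (partial_v x u v) <> zero.

(** Being chosen by [epsilon], the shape operator is accessible only through its specification:
    linearity on tangent vectors and its values on the two partials. *)
Lemma shape_operator_combination (a b : R) :
  shape_operator x u v (plus (scal a (partial_u x u v)) (scal b (partial_v x u v)))
  = plus (scal (- a) (partial_u (unit_normal x) u v))
         (scal (- b) (partial_v (unit_normal x) u v)).
Proof.
destruct (shape_operatorP _ _ _ regular) as [A [M [Eu Ev]]].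
destruct tangent_partial as [Tu Tv].
rewrite A, !M, Eu, Ev; [|assumption|assumption|apply tangent_scal; assumption
  |apply tangent_scal; assumption].
E3_calc; ring.
Qed.

End ShapeOperator.

(** The third form applies the shape operator twice, and linearity is specified only on tangent
    vectors. The image is tangent because derivatives of a unit normal are orthogonal to it. *)
Lemma shape_operator_tangent (U : R * R -> Prop) (x : R -> R -> E3) (u v : R) (a : E3) :
  regular_patch U x -> U (u, v) -> tangent x u v a ->
  tangent x u v (shape_operator x u v a).
Proof.
intros HX H [k [l ->]].
pose proof (proj2 (proj2 HX)) as Hn.
destruct (open_slices _ _ _ (proj1 HX) H) as [Lu Lv].
destruct (unit_normal_derive _ _ _ _ HX H) as [Du Dv].
assert (T : forall w, dot w (unit_normal x u v) = 0 -> tangent x u v w).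
{ intros w Hw; apply orthogonal_cross_span; [now apply Hn|].
  unfold unit_normal in Hw; pose proof (enorm_pos _ (Hn u v H)) as Hp.
  (* Writing [w] as [scal 1 w] lets [dot_scal] extract the nonzero normalizing factor, leaving
     orthogonality to the cross product itself. *)
  rewrite <- (scal_one w : scal 1 w = w), dot_scal in Hw.
  apply Rmult_integral in Hw; destruct Hw as [Hw|Hw]; [|exact Hw].
  rewrite Rmult_1_l in Hw; apply Rinv_neq_0_compat in Hw; [easy|lra]. }
rewrite shape_operator_combination by now apply Hn.
apply tangent_plus; apply tangent_scal, T.
- apply (unit_curve_orthogonal _ _ _) in Du; [exact Du|].
  apply (filter_imp _ _ (fun s Hs => unit_normal_unit x s v (Hn s v Hs)) Lu).
- apply (unit_curve_orthogonal _ _ _) in Dv; [exact Dv|].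
  apply (filter_imp _ _ (fun s Hs => unit_normal_unit x u s (Hn u s Hs)) Lv).
Qed.

(** * Normal, shape operator and third form of the inverse patch *)

Section InversePatch.

Variables (c : E3) (r : R) (U : R * R -> Prop) (x : R -> R -> E3).
Hypotheses (r_pos : 0 < r) (patch_x : regular_patch U x)
  (off_center : forall u v : R, U (u, v) -> x u v <> c).

Let y (u v : R) : E3 := inversion c r (x u v).
Let d (u v : R) : E3 := minus (x u v) c.
Let lambda (u v : R) : R := r ^ 2 / dot (d u v) (d u v).

Let d_neq0 (u v : R) : U (u, v) -> d u v <> zero.
Proof. intros H; apply minus_neq0, off_center, H. Qed.

Let lambda_pos (u v : R) : U (u, v) -> 0 < lambda u v.
Proof.
intros H; apply Rdiv_lt_0_compat; [apply pow_lt, r_pos | apply dot_pos, d_neq0, H].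
Qed.

Lemma inverse_patch_partial (u v : R) : U (u, v) ->
  partial_u y u v = scal (lambda u v) (refl (d u v) (partial_u x u v)) /\
  partial_v y u v = scal (lambda u v) (refl (d u v) (partial_v x u v)).
Proof.
intros H; destruct (regular_patch_derive _ _ _ _ patch_x H) as [Du Dv].
pose proof (off_center _ _ H) as Hc.
split; unfold lambda, d; rewrite <- inversion_tangent_refl by exact Hc;
  apply is_curve_derive_unique.
- exact (is_curve_derive_inversion c r _ _ _ Du Hc).
- exact (is_curve_derive_inversion c r _ _ _ Dv Hc).
Qed.

Lemma inverse_patch_cross (u v : R) : U (u, v) ->
  cross (partial_u y u v) (partial_v y u v)
  = scal (- lambda u v ^ 2) (refl (d u v) (cross (partial_u x u v) (partial_v x u v))).
Proof.
intros H; destruct (inverse_patch_partial _ _ H) as [-> ->].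
rewrite cross_scal, cross_refl by now apply d_neq0.
rewrite scal_assoc; f_equal; unfold mult; simpl; ring.
Qed.

(** Since [refl] preserves length, normalizing cancels [lambda ^ 2] and keeps only the sign due to
    the reversed orientation. *)
Lemma inverse_patch_unit_normal (u v : R) : U (u, v) ->
  unit_normal y u v = scal (-1) (refl (d u v) (unit_normal x u v)).
Proof.
intros H; unfold unit_normal; rewrite inverse_patch_cross by exact H.
pose proof (lambda_pos _ _ H) as Hl; pose proof (pow_lt _ 2 Hl) as Hl2.
pose proof (enorm_pos _ (proj2 (proj2 patch_x) u v H)) as Hn.
rewrite enorm_scal, enorm_refl, Rabs_Ropp, Rabs_right, refl_scal, !scal_assoc
  by (try apply d_neq0; try exact H; lra).
f_equal; unfold mult; simpl in *; field; lra.
Qed.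

Lemma inverse_patch_regular (u v : R) : U (u, v) ->
  cross (partial_u y u v) (partial_v y u v) <> zero.
Proof.
intros H E.
pose proof (dot_pos _ (proj2 (proj2 patch_x) u v H)) as Hn.
pose proof (pow_lt _ 2 (lambda_pos _ _ H)) as Hl.
rewrite inverse_patch_cross in E by exact H.
(* Squared lengths reduce the contradiction to [lambda ^ 4] times a positive number being zero. *)
apply (f_equal (fun w => dot w w)) in E.
rewrite dot_scal, dot_refl in E by now apply d_neq0.
replace (dot zero zero) with 0 in E by (E3_unfold; ring).
pose proof (Rmult_lt_0_compat _ _ (Rmult_lt_0_compat _ _ Hl Hl) Hn); lra.
Qed.

Let xi (u v : R) : R := 2 * dot (unit_normal x u v) (d u v) / dot (d u v) (d u v).

(** The formula for the normal of [y] holds on the open set [U], hence near the parameter on each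
    coordinate line, and may be differentiated there. Orthogonality of the normal of [x] to the
    partials supplies the remaining hypothesis. *)
Lemma inverse_patch_normal_partial (u v : R) : U (u, v) ->
  partial_u (unit_normal y) u v
  = scal (-1) (refl (d u v)
      (plus (partial_u (unit_normal x) u v) (scal (- xi u v) (partial_u x u v)))) /\
  partial_v (unit_normal y) u v
  = scal (-1) (refl (d u v)
      (plus (partial_v (unit_normal x) u v) (scal (- xi u v) (partial_v x u v)))).
Proof.
intros H; destruct (open_slices _ _ _ (proj1 patch_x) H) as [Lu Lv].
destruct (regular_patch_derive _ _ _ _ patch_x H) as [Du Dv].
destruct (unit_normal_derive _ _ _ _ patch_x H) as [Nu Nv].
destruct (unit_normal_orthogonal x u v) as [Ou Ov].
pose proof (off_center _ _ H) as Hc.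
pose proof (is_curve_derive_reflected_normal c _ _ _ _ _ Du Nu Hc Ou) as Eu.
pose proof (is_curve_derive_reflected_normal c _ _ _ _ _ Dv Nv Hc Ov) as Ev.
split; apply is_curve_derive_unique.
- refine (is_curve_derive_ext_loc _ _ _ _ _ Eu).
  apply (filter_imp _ _ (fun s Hs => eq_sym (inverse_patch_unit_normal s v Hs)) Lu).
- refine (is_curve_derive_ext_loc _ _ _ _ _ Ev).
  apply (filter_imp _ _ (fun s Hs => eq_sym (inverse_patch_unit_normal u s Hs)) Lv).
Qed.

(** The scaled reflection carries the partials of [x] to those of [y], so by linearity the formulas
    for the partials of the two normals suffice. *)
Lemma inverse_patch_shape_operator (u v : R) (a : E3) : U (u, v) -> tangent x u v a ->
  shape_operator y u v (scal (lambda u v) (refl (d u v) a))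
  = scal (-1) (refl (d u v) (plus (shape_operator x u v a) (scal (xi u v) a))).
Proof.
intros H [k [l ->]].
rewrite shape_operator_combination by exact (proj2 (proj2 patch_x) u v H).
replace (scal (lambda u v) (refl (d u v)
          (plus (scal k (partial_u x u v)) (scal l (partial_v x u v)))))
  with (plus (scal k (partial_u y u v)) (scal l (partial_v y u v))).
- rewrite shape_operator_combination by now apply inverse_patch_regular.
  destruct (inverse_patch_normal_partial _ _ H) as [-> ->].
  rewrite !refl_plus, !refl_scal, !refl_plus, !refl_scal.
  generalize (refl (d u v) (partial_u x u v)) (refl (d u v) (partial_v x u v))
    (refl (d u v) (partial_u (unit_normal x) u v)) (refl (d u v) (partial_v (unit_normal x) u v)).
  intros [[e1 e2] e3] [[f1 f2] f3] [[g1 g2] g3] [[h1 h2] h3]; E3_ext; ring.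
- destruct (inverse_patch_partial _ _ H) as [-> ->].
  rewrite refl_plus, !refl_scal.
  generalize (refl (d u v) (partial_u x u v)) (refl (d u v) (partial_v x u v)).
  intros [[e1 e2] e3] [[f1 f2] f3]; E3_ext; ring.
Qed.

Lemma inverse_patch_third_form (u v : R) (a b : E3) :
  U (u, v) -> tangent x u v a ->
  third_form y u v (scal (lambda u v) (refl (d u v) a)) (scal (lambda u v) (refl (d u v) b))
  = third_form x u v a b + 2 * xi u v * second_form x u v a b
    + xi u v ^ 2 * first_form x u v a b.
Proof.
intros H Ta; unfold third_form, second_form, first_form.
pose proof (shape_operator_tangent _ _ _ _ _ patch_x H Ta) as TSa.
rewrite inverse_patch_shape_operator by assumption.
set (w := plus (shape_operator x u v a) (scal (xi u v) a)).
assert (Tw : tangent x u v w) by (apply tangent_plus; [|apply tangent_scal]; assumption).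
pose proof (lambda_pos _ _ H) as Hl.
(* To apply the shape operator of [y] again, its first value must be the image of a tangent vector
   of [x] under the scaled reflection; that vector is [- w / lambda]. *)
replace (scal (-1) (refl (d u v) w))
  with (scal (lambda u v) (refl (d u v) (scal (- / lambda u v) w)))
  by (rewrite refl_scal, scal_assoc; f_equal; unfold mult; simpl; field; lra).
rewrite inverse_patch_shape_operator by (try apply tangent_scal; assumption).
destruct (shape_operatorP _ _ _ (proj2 (proj2 patch_x) u v H)) as [A [M _]].
(* The isometry removes both reflections; the factor [lambda] from the second argument will cancel
   the [/ lambda] in the first. *)
rewrite dot_scal, dot_refl by now apply d_neq0.
rewrite M by assumption; unfold w at 1; rewrite A, M;
  [|assumption|assumption|apply tangent_scal; assumption].
unfold w; generalize dependent (lambda u v); intros q Hq.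
generalize (shape_operator x u v (shape_operator x u v a)) (shape_operator x u v a) (xi u v).
clear - Hq; intros [[e1 e2] e3] [[f1 f2] f3] k.
destruct a as [[a1 a2] a3], b as [[b1 b2] b3]; E3_unfold; field; lra.
Qed.

End InversePatch.

Theorem lemma4p1 :
  forall (c : E3) (r : R) (U : R * R -> Prop) (x : R -> R -> E3),
    0 < r ->
    regular_patch U x ->
    (forall u v : R, U (u, v) -> x u v <> c) ->
    let y := fun u v : R => inversion c r (x u v) in
    forall (u v : R), U (u, v) ->
    let p := x u v in
    let xi := 2 * dot (unit_normal x u v) (minus p c) / enorm (minus p c) ^ 2 in
    forall a b : E3, tangent x u v a -> tangent x u v b ->
      third_form y u v (inversion_tangent c r p a) (inversion_tangent c r p b)
      = third_form x u v a b + 2 * xi * second_form x u v a b + xi ^ 2 * first_form x u v a b.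
Proof.
intros c r U x Hr HX Hc y u v H p xi a b Ta _.
unfold p, xi; rewrite !inversion_tangent_refl, enorm_sq by now apply Hc.
exact (inverse_patch_third_form c r U x Hr HX Hc u v a b H Ta).
Qed.
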